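(* Let $m\ge 1$, let $C\in\mathbb{R}^{3\times m}$, and let $A,B^t\in\mathcal{Q}_0(C)$ (so $A\in\mathbb{R}^{3\times m}$, $B\in\mathbb{R}^{m\times 3}$). Suppose the DSR graph $G_{A,B}$ satisfies: (i) every e-cycle of length $4$ in $G_{A,B}$ is an s-cycle; and (ii) every o-cycle of length $6$ in $G_{A,B}$ is an s-cycle. Then the DSR$^{[2]}$ graph $G^{[2]}_{A,B}$ is odd$^*$, $(AB)^{[2]}$ is a $P_0$-matrix, and no nonreal eigenvalue of $AB$ lies in the open left half-plane $\mathbb{C}_-$.
   Context: For $M\in\mathbb{R}^{n\times m}$, the qualitative class $\mathcal{Q}(M)$ is the set of all $X\in\mathbb{R}^{n\times m}$ with $\mathrm{sign}(X_{ij})=\mathrm{sign}(M_{ij})$ for all $i,j$; $\mathcal{Q}_0(M)$ denotes its closure. A square real matrix is a $P_0$-matrix if all its principal minors are nonnegative. For $M\in\mathbb{R}^{n\times n}$, $n\ge2$, the second additive compound $M^{[2]}$ is the $\binom n2\times\binom n2$ matrix of the linear map $u\wedge v\mapsto Mu\wedge v+u\wedge Mv$ on $\Lambda^2\mathbb{R}^n$ with respect to the basis $e_i\wedge e_j$ ($i<j$) in lexicographic order. DSR graphs: for $A\in\mathbb{R}^{n\times m}$, $B\in\mathbb{R}^{m\times n}$, $G_{A,B}$ is the signed, labelled bipartite digraph with S-vertices $S_1,\dots,S_n$ and R-vertices $R_1,\dots,R_m$, having an arc $R_j\to S_i$ of sign $\mathrm{sign}(A_{ij})$ iff $A_{ij}\ne0$,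 and an arc $S_i\to R_j$ of sign $\mathrm{sign}(B_{ji})$ iff $B_{ji}\neq 0$. A pair of antiparallel arcs between $S_i$ and $R_j$ with the same sign is regarded as a single undirected edge (traversable in either direction). An edge arising from $A_{ij}\ne0$ (R-to-S or undirected) has label $|A_{ij}|$; an edge with only S-to-R orientation has label $\infty$. A walk is an alternating sequence of vertices and edges, each edge traversed consistently with its orientation; vertices and edges may repeat; its length is the number of edges with multiplicity; it is closed if its first and last vertices coincide. The sign of a walk is the product of the signs of its edges (with multiplicity). A cycle is a nonempty closed walk repeating no vertex except first$=$last (so a 2-cycle needs two distinct edges between the same pair of vertices). Closed walks have even length; the parity of a walk $W$ of even length is $P(W)=(-1)^{|W|/2}\mathrm{sign}(W)$; a cycle is an e-cycle if $P=1$ and an o-cycle if $P=-1$. A closed walk $(e_1,\dots,e_{2r})$ is an s-walk if all its labels are finite and $\prod_{i=1}^r l(e_{2i-1})=\prod_{i=1}^r l(e_{2i})$; an s-cycle is a cycle that is an s-walk. Two cycles are compatibly oriented if they can be oriented so that each induces the same direction on every edge they share; they have odd intersection if they are compatibly oriented and every connected component of their intersection has odd length. A DSR graph is odd$^*$ if all its e-cycles are s-cycles and no two e-cycles have odd intersection. DSR$^{[2]}$ graph: for $n\ge2$, define $\overline{\mathbf L}^A\in\mathbb{R}^{\binom n2\times mn}$, rows indexed by pairs $(i,j)$, $1\le i<j\le n$, columns by pairs $(k,l)$, $1\le k\le m$, $1\le l\le n$, with $\overline{\mathbf L}^A_{(i,j),(k,l)}=A_{jk}$ if $l=i$, $=-A_{ik}$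 if $l=j$, and $0$ otherwise; and $\underline{\mathbf L}^B\in\mathbb{R}^{mn\times\binom n2}$ with $\underline{\mathbf L}^B_{(k,l),(i,j)}=B_{kj}$ if $l=i$, $=-B_{ki}$ if $l=j$, $0$ otherwise. Then $G^{[2]}_{A,B}:=G_{\overline{\mathbf L}^A,\underline{\mathbf L}^B}$. *)

(* Defs.v *)
From HB Require Import structures.
From mathcomp Require Import all_boot all_order all_algebra.
From mathcomp Require Import reals.
From mathcomp Require Import complex.

Set Implicit Arguments.
Unset Strict Implicit.
Unset Printing Implicit Defensive.

Import Order.TTheory GRing.Theory Num.Theory.
Local Open Scope ring_scope.

(* Q0(M) = closure of Q(M) = { X | each X_ij is 0 or has the sign of M_ij } *)
Definition Q0 (R : realType) (n m : nat) (M : 'M[R]_(n, m)) : 'M[R]_(n, m) -> Prop :=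
  fun X => forall i j, X i j = 0 \/ Num.sg (X i j) = Num.sg (M i j).

Definition principal_submx (R : realType) (N : nat) (M : 'M[R]_N) (S : {set 'I_N})
  : 'M[R]_#|S| :=
  \matrix_(a < #|S|, b < #|S|) M (enum_val a) (enum_val b).

Definition P0_matrix (R : realType) (N : nat) (M : 'M[R]_N) : Prop :=
  forall S : {set 'I_N}, 0 <= \det (principal_submx M S).

(* Index set {(i,j) | i < j} for Lambda^2 R^n; its enumeration is
   lexicographic (enumeration of a subtype of a product type).           *)
Definition pairs (n : nat) := {p : 'I_n * 'I_n | (p.1 < p.2)%N}.

(* Entries of the second additive compound, indexed by pairs:
   M e_k /\ e_l + e_k /\ M e_l, coefficient on e_i /\ e_j.              *)
Definition compound2_entry (R : realType) (n : nat) (M : 'M[R]_n)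
    (p q : pairs n) : R :=
  let i := (val p).1 in let j := (val p).2 in
  let k := (val q).1 in let l := (val q).2 in
  (l == j)%:R * M i k - (l == i)%:R * M j k
  + (k == i)%:R * M j l - (k == j)%:R * M i l.

Definition compound2 (R : realType) (n : nat) (M : 'M[R]_n) : 'M[R]_#|{: pairs n}| :=
  \matrix_(a, b) compound2_entry M (enum_val a) (enum_val b).

Section DSR.
Variables (R : realType) (I J : finType) (A : I -> J -> R) (B : J -> I -> R).

(* An edge between S_i and R_j is (i, j, k) with
     k = None        : undirected edge (A_ij, B_ji nonzero, same sign)
     k = Some false  : arc R_j -> S_i only (from A_ij)
     k = Some true   : arc S_i -> R_j only (from B_ji)                   *)
Definition edge := (I * J * option bool)%type.

Definition both_same_sign (i : I) (j : J) : bool :=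
  [&& A i j != 0, B j i != 0 & Num.sg (A i j) == Num.sg (B j i)].

Definition is_edge (e : edge) : bool :=
  let: (i, j, k) := e in
  match k with
  | None => both_same_sign i j
  | Some false => (A i j != 0) && ~~ both_same_sign i j
  | Some true => (B j i != 0) && ~~ both_same_sign i j
  end.

Definition edge_sign (e : edge) : R :=
  let: (i, j, k) := e in
  match k with
  | Some true => Num.sg (B j i)
  | _ => Num.sg (A i j)
  end.

(* label: Some |A_ij| (finite) or None (= infinity) *)
Definition edge_label (e : edge) : option R :=
  let: (i, j, k) := e in
  match k with
  | Some true => None
  | _ => Some `|A i j|
  end.

Definition label_val (e : edge) : R :=
  if edge_label e is Some x then x else 0.

(* vertices: inl i = S_i, inr j = R_j *)
Definition vertex := (I + J)%type.

(* a step = an edge together with a direction of traversal: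
   true = from S to R, false = from R to S                              *)
Definition step := (edge * bool)%type.

Definition allowed_step (s : step) : bool :=
  is_edge s.1 && (if s.1.2 is Some b then s.2 == b else true).

Definition src (s : step) : vertex :=
  if s.2 then inl s.1.1.1 else inr s.1.1.2.
Definition tgt (s : step) : vertex :=
  if s.2 then inr s.1.1.2 else inl s.1.1.1.

Definition closed_walk (w : seq step) : bool :=
  [&& w != [::], all allowed_step w & cycle (fun s t => tgt s == src t) w].

Definition is_cycle (w : seq step) : bool :=
  [&& closed_walk w, uniq (map src w) & uniq (map fst w)].

Definition walk_sign (w : seq step) : R := \prod_(s <- w) edge_sign s.1.

Definition parity (w : seq step) : R := (-1) ^+ (size w)./2 * walk_sign w.

Definition e_cycle (w : seq step) : bool := is_cycle w && (parity w == 1).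
Definition o_cycle (w : seq step) : bool := is_cycle w && (parity w == -1).

Definition s_walk (w : seq step) : bool :=
  [&& closed_walk w,
      all (fun s => edge_label s.1 != None) w &
      \prod_(p <- zip (iota 0 (size w)) w | ~~ odd p.1) label_val p.2.1
      == \prod_(p <- zip (iota 0 (size w)) w | odd p.1) label_val p.2.1].

Definition s_cycle (w : seq step) : bool := is_cycle w && s_walk w.

Definition rev_walk (w : seq step) : seq step := rev [seq (s.1, ~~ s.2) | s <- w].

Definition compatibly_oriented (w1 w2 : seq step) : Prop :=
  exists w1' w2' : seq step,
    [/\ w1' = w1 \/ w1' = rev_walk w1,
        w2' = w2 \/ w2' = rev_walk w2,
        all allowed_step w1', all allowed_step w2' &
        forall (e : edge) (d1 d2 : bool), (e, d1) \in w1' -> (e, d2) \in w2' -> d1 = d2].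

Definition common_vertex (w1 w2 : seq step) (v : vertex) : bool :=
  (v \in map src w1) && (v \in map src w2).
Definition common_edge (w1 w2 : seq step) (e : edge) : bool :=
  (e \in map fst w1) && (e \in map fst w2).

Definition inter_adj (w1 w2 : seq step) : rel vertex :=
  fun u v => [exists e : edge, common_edge w1 w2 e &&
     (((u == inl e.1.1) && (v == inr e.1.2)) || ((v == inl e.1.1) && (u == inr e.1.2)))].

Definition component_length (w1 w2 : seq step) (v : vertex) : nat :=
  #|[set e : edge | common_edge w1 w2 e && connect (inter_adj w1 w2) v (inl e.1.1)]|.

Definition odd_intersection (w1 w2 : seq step) : Prop :=
  [/\ compatibly_oriented w1 w2,
      exists v, common_vertex w1 w2 v &
      forall v, common_vertex w1 w2 v -> odd (component_length w1 w2 v)].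

Definition odd_star : Prop :=
  (forall w, e_cycle w -> s_cycle w) /\
  (forall w1 w2, e_cycle w1 -> e_cycle w2 -> ~ odd_intersection w1 w2).

End DSR.

Definition LA (R : realType) (n m : nat) (A : 'M[R]_(n, m))
    : pairs n -> 'I_m * 'I_n -> R :=
  fun p kl =>
    if kl.2 == (val p).1 then A (val p).2 kl.1
    else if kl.2 == (val p).2 then - A (val p).1 kl.1 else 0.

Definition LB (R : realType) (n m : nat) (B : 'M[R]_(m, n))
    : 'I_m * 'I_n -> pairs n -> R :=
  fun kl p =>
    if kl.2 == (val p).1 then B kl.1 (val p).2
    else if kl.2 == (val p).2 then - B kl.1 (val p).1 else 0.

Definition DSR_odd_star (R : realType) (n m : nat) (A : 'M[R]_(n, m)) (B : 'M[R]_(m, n)) :=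
  odd_star (fun i j => A i j) (fun j i => B j i).

Definition DSR2_odd_star (R : realType) (n m : nat) (A : 'M[R]_(n, m)) (B : 'M[R]_(m, n)) :=
  odd_star (LA A) (LB B).

(* Main.v *)
Require Import Defs.
From HB Require Import structures.
From mathcomp Require Import all_boot all_order all_algebra.
From mathcomp Require Import reals.
From mathcomp Require Import complex.
From mathcomp Require Import perm ring lra.

Import Order.TTheory GRing.Theory Num.Theory.
Local Open Scope ring_scope.

(** For [n = 3] an R-vertex [(k, l)] of the DSR^[2] graph has at most two
neighbours, the pairs containing [l].  Two cycles through a common R-vertex thus
share both of its edges, so every component of an intersection has even length
and odd intersections do not occur.  Since [A] and [B^T] have compatible signs
there are no 2-cycles, so cycles of the DSR^[2] graph have length 4 or 6.
Labelling a pair by the index it omits, a 4-cycle is a 4-cycle of [G_{A,B}] of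
the same parity, and a 6-cycle is a closed 6-walk of [G_{A,B}] of the opposite
parity through all three S-vertices; if that walk repeats an R-vertex, cancelling
an edge traversed back and forth leaves a 4-cycle of the opposite parity, or
nothing.  Hence (i) and (ii) make all e-cycles s-cycles.

The same conditions say that each product of a minor of [LA] with the
corresponding minor of [LB] is nonnegative, so by Cauchy-Binet the second
compound of [M = AB] is a P0-matrix.  Its determinant is [e1 e2 - e3] in terms of
the coefficients of the characteristic polynomial of [M]; if [a + ib] is a nonreal
eigenvalue this equals [2 a ((e1 - a)^2 + b^2)], whence [a >= 0]. *)

(** * Cycles of a sign-compatible DSR graph in terms of matrix entries *)

Section SignedGraph.

Variables (R : realType) (I J : finType) (A : I -> J -> R) (B : J -> I -> R).

Definition sign_compatible :=
  forall i j, A i j != 0 -> B j i != 0 -> Num.sg (A i j) = Num.sg (B j i).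

Hypothesis AB : sign_compatible.

Lemma sign_compatible_mul_ge0 i j : 0 <= A i j * B j i.
Proof.
have [->|A0] := eqVneq (A i j) 0; first by rewrite mul0r.
have [->|B0] := eqVneq (B j i) 0; first by rewrite mulr0.
by rewrite -sgr_ge0 sgrM AB // -expr2 sqr_ge0.
Qed.

Lemma both_same_signE i j :
  both_same_sign A B i j = (A i j != 0) && (B j i != 0).
Proof.
rewrite /both_same_sign; case: (boolP (A i j != 0)) => //= A0.
by case: (boolP (B j i != 0)) => //= B0; rewrite AB ?eqxx.
Qed.

(** Parallel edges would need two nonzero entries of opposite sign, which sign compatibility
    forbids. *)
Lemma is_edge_inj (e f : edge I J) :
  is_edge A B e -> is_edge A B f -> e.1 = f.1 -> e = f.
Proof.
case: e f => [[i j] k] [[i' j'] k'] /= He Hf [? ?]; subst i' j'.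
move: He Hf; rewrite both_same_signE.
by case: k k' => [[]|] [[]|] //=; case: (A i j == 0); case: (B j i == 0).
Qed.

Definition entry (s : step I J) : R :=
  if s.2 then B s.1.1.2 s.1.1.1 else A s.1.1.1 s.1.1.2.

(** An undirected edge takes its sign from [A]; when it is walked from S to R, sign compatibility
    lets [B] be read instead. *)
Lemma edge_sign_entry s : allowed_step A B s ->
  edge_sign A B s.1 = Num.sg (entry s).
Proof.
case: s => [[[i j] k] d]; rewrite /allowed_step /entry /= both_same_signE.
case: k d => [[]|] [] //=; rewrite ?andbT ?andbF // => /andP[A0 B0].
exact: AB.
Qed.

Lemma edge_label_finite s : allowed_step A B s ->
  (edge_label A s.1 != None) = (A s.1.1.1 s.1.1.2 != 0).
Proof.
case: s => [[[i j] k] d]; rewrite /allowed_step /= both_same_signE.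
case: k d => [[]|] [] //=; rewrite ?andbT ?andbF //;
  by case: (A i j == 0); case: (B j i == 0).
Qed.

(** The default value 0 of an infinite label agrees with [A], which vanishes on an arc going only
    from S to R. *)
Lemma label_val_entry s : allowed_step A B s ->
  label_val A s.1 = `|A s.1.1.1 s.1.1.2|.
Proof.
case: s => [[[i j] k] d]; rewrite /allowed_step /label_val /= both_same_signE.
case: k d => [[]|] [] //=; rewrite ?andbT ?andbF //.
by have [->|] := eqVneq (A i j) 0; rewrite ?normr0 //; case: (B j i == 0).
Qed.

Definition mk_step (i : I) (j : J) (d : bool) : step I J :=
  ((i, j, if both_same_sign A B i j then None else Some d), d).

Lemma mk_step_allowed i j d :
  (if d then B j i else A i j) != 0 -> allowed_step A B (mk_step i j d).
Proof.
rewrite /allowed_step /mk_step /=.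
by case E: (both_same_sign A B i j) => /=; case: d; rewrite /= ?E ?eqxx ?andbT.
Qed.

Lemma walk_sign_entry w : all (allowed_step A B) w ->
  walk_sign A B w = Num.sg (\prod_(s <- w) entry s).
Proof.
rewrite /walk_sign; elim: w => [|s w IH] /=; first by rewrite !big_nil sgr1.
by case/andP=> hs /IH e; rewrite !big_cons sgrM e edge_sign_entry.
Qed.

(* [four_cond] says that e-cycles of length 4 are s-cycles.  [six_cond e] says
   the same of 6-cycles of sign [e]: o-cycles for [e = 1], e-cycles for [e = -1]. *)
Definition four_cond := forall i i' j j', i != i' -> j != j' ->
  0 < B j i * A i' j * B j' i' * A i j' ->
  A i j * A i' j' = A i' j * A i j'.

Definition six_cond (e : R) := forall i1 i2 i3 j1 j2 j3,
  uniq [:: i1; i2; i3] -> uniq [:: j1; j2; j3] ->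
  0 < e * (B j1 i1 * A i2 j1 * B j2 i2 * A i3 j2 * B j3 i3 * A i1 j3) ->
  A i1 j1 * A i2 j2 * A i3 j3 = e * (A i2 j1 * A i3 j2 * A i1 j3).

Lemma gt0_eq (x y : R) : 0 < x -> x = y -> 0 < y.
Proof. by move=> ? <-. Qed.

Lemma ge0_eq (x y : R) : 0 <= x -> x = y -> 0 <= y.
Proof. by move=> ? <-. Qed.

(** Labels compare only absolute values; the parity of the cycle supplies the sign. *)
Lemma norm_eq_mul_gt0 (x y : R) : `|x| = `|y| -> 0 < x * y -> x = y.
Proof.
move=> /eqP; rewrite eqr_norm2 => /orP[/eqP//|/eqP xy] p.
by move: p; rewrite xy mulNr -expr2 oppr_gt0 ltNge sqr_ge0.
Qed.

Lemma s_walk4 (s1 s2 s3 s4 : step I J) : let w := [:: s1; s2; s3; s4] in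
  closed_walk A B w ->
  s_walk A B w = all (fun s => A s.1.1.1 s.1.1.2 != 0) w &&
    (`|A s1.1.1.1 s1.1.1.2 * A s3.1.1.1 s3.1.1.2| ==
     `|A s2.1.1.1 s2.1.1.2 * A s4.1.1.1 s4.1.1.2|).
Proof.
move=> w cw; rewrite /s_walk cw /=.
case/and3P: cw => _ /= /and5P[h1 h2 h3 h4 _] _.
rewrite !edge_label_finite // !big_cons !big_nil /=.
by rewrite !label_val_entry // !mulr1 !normrM.
Qed.

Lemma s_walk6 (s1 s2 s3 s4 s5 s6 : step I J) :
  let w := [:: s1; s2; s3; s4; s5; s6] in
  closed_walk A B w ->
  s_walk A B w = all (fun s => A s.1.1.1 s.1.1.2 != 0) w &&
    (`|A s1.1.1.1 s1.1.1.2 * A s3.1.1.1 s3.1.1.2 * A s5.1.1.1 s5.1.1.2| ==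
     `|A s2.1.1.1 s2.1.1.2 * A s4.1.1.1 s4.1.1.2 * A s6.1.1.1 s6.1.1.2|).
Proof.
move=> w cw; rewrite /s_walk cw /=.
case/and3P: cw => _ /= /and5P[h1 h2 h3 h4 /and3P[h5 h6 _]] _.
rewrite !edge_label_finite // !big_cons !big_nil /=.
by rewrite !label_val_entry // !mulr1 !normrM !mulrA.
Qed.

Lemma inl_eq (i i' : I) : (inl i == inl i' :> I + J) = (i == i').
Proof. by []. Qed.

Lemma inr_eq (j j' : J) : (inr j == inr j' :> I + J) = (j == j').
Proof. by []. Qed.

Lemma four_cycles_four_cond :
  (forall w, size w = 4%N -> e_cycle A B w -> s_cycle A B w) -> four_cond.
Proof.
move=> H i i' j j' ni nj P0.
have /and4P[b1 a1 b2 a2] :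
    [&& B j i != 0, A i' j != 0, B j' i' != 0 & A i j' != 0].
  by move: (lt0r_neq0 P0); rewrite !mulf_eq0 !negb_or -!andbA.
pose w := [:: mk_step i j true; mk_step i' j false;
              mk_step i' j' true; mk_step i j' false].
have al : all (allowed_step A B) w by rewrite /= !mk_step_allowed.
have cw : closed_walk A B w by rewrite /closed_walk al /= /tgt /src /= !eqxx.
have ic : is_cycle A B w.
  rewrite /is_cycle cw /= /src /= !inE /= !xpair_eqE !inl_eq !inr_eq.
  by rewrite (eq_sym i' i) (negbTE ni) (negbTE nj) /= ?andbF ?orbF.
have ec : e_cycle A B w.
  rewrite /e_cycle ic /parity walk_sign_entry // !big_cons big_nil /entry /=.
  by rewrite mulr1 expr2 mulrNN !mul1r !mulrA gtr0_sg.
have /andP[_] := H w erefl ec.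
rewrite s_walk4 //= => /andP[/and5P[A1 A2 A3 A4 _] /eqP e].
apply: norm_eq_mul_gt0 => //.
(* Finite labels make the entries of [A] on the S-to-R steps nonzero, so their signs may replace
   those of [B] in [P0]. *)
rewrite -sgr_gt0 -[X in 0 < X](_ : Num.sg (B j i * A i' j * B j' i' * A i j') = _)
  ?sgr_gt0 // !sgrM -(AB _ _ A1) // -(AB _ _ A3) //; ring.
Qed.

Lemma six_cycles_six_cond :
  (forall w, size w = 6%N -> o_cycle A B w -> s_cycle A B w) -> six_cond 1.
Proof.
move=> H i1 i2 i3 j1 j2 j3; rewrite /= !inE !negb_or !andbT.
move=> /andP[/andP[n12 n13] n23] /andP[/andP[m12 m13] m23].
rewrite !mul1r => P0.
have /and5P[b1 a2 b2 a3 /andP[b3 a1]] :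
    [&& B j1 i1 != 0, A i2 j1 != 0, B j2 i2 != 0, A i3 j2 != 0, B j3 i3 != 0 &
        A i1 j3 != 0].
  by move: (lt0r_neq0 P0); rewrite !mulf_eq0 !negb_or -!andbA.
pose w := [:: mk_step i1 j1 true; mk_step i2 j1 false;
              mk_step i2 j2 true; mk_step i3 j2 false;
              mk_step i3 j3 true; mk_step i1 j3 false].
have al : all (allowed_step A B) w by rewrite /= !mk_step_allowed.
have cw : closed_walk A B w by rewrite /closed_walk al /= /tgt /src /= !eqxx.
have ic : is_cycle A B w.
  rewrite /is_cycle cw /= /src /= !inE /= !xpair_eqE !inl_eq !inr_eq.
  rewrite (eq_sym i2 i1) ?(eq_sym i3 i1) ?(eq_sym i3 i2).
  rewrite (negbTE n12) (negbTE n13) (negbTE n23).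
  by rewrite (negbTE m12) (negbTE m13) (negbTE m23) /= ?andbF ?orbF.
have oc : o_cycle A B w.
  rewrite /o_cycle ic /parity walk_sign_entry // !big_cons big_nil /entry /=.
  by rewrite -signr_odd expr1 !mulrA !mulr1 gtr0_sg ?mulr1.
have /andP[_] := H w erefl oc.
rewrite s_walk6 //= => /andP[/and5P[A1 A2 A3 A4 /and3P[A5 A6 _]] /eqP e].
apply: norm_eq_mul_gt0 => //.
rewrite -sgr_gt0 -[X in 0 < X](_ : Num.sg
  (B j1 i1 * A i2 j1 * B j2 i2 * A i3 j2 * B j3 i3 * A i1 j3) = _)
  ?sgr_gt0 // !sgrM -(AB _ _ A1) // -(AB _ _ A3) // -(AB _ _ A5) //; ring.
Qed.

Lemma e_cycle_prod w : e_cycle A B w ->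
  0 < (-1) ^+ (size w)./2 * \prod_(s <- w) entry s.
Proof.
case/andP=> /and3P[/and3P[_ al _] _ _].
rewrite /parity walk_sign_entry // => /eqP e.
rewrite -sgr_gt0 sgrM -(_ : (-1) ^+ (size w)./2 = Num.sg ((-1) ^+ (size w)./2)).
  by rewrite e.
by rewrite sgrX sgrN1.
Qed.

Lemma four_cond_four_cycles : four_cond ->
  forall w, size w = 4%N -> e_cycle A B w -> s_cycle A B w.
Proof.
move=> K; case=> [|s1 [|s2 [|s3 [|s4 [|]]]]] // _ ew.
have := e_cycle_prod _ ew.
case/andP: ew => ic _; rewrite /s_cycle ic /=.
case/and3P: (ic) => cw us _; rewrite s_walk4 //.
case/and3P: cw => _ _ /and5P[c1 c2 c3 c4 _].
rewrite !big_cons big_nil expr2 mulrNN !mul1r mulr1 !mulrA.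
move: us c1 c2 c3 c4; case: s1 s2 s3 s4 {ic} => [[[i1 j1] k1] d1] [[[i2 j2] k2] d2]
  [[[i3 j3] k3] d3] [[[i4 j4] k4] d4].
rewrite /entry /tgt /src /=.
(* Directions alternate, so two cases remain: the walk starts at an S-vertex or at an R-vertex. *)
case: d1; case: d2; case: d3; case: d4 => //= us;
  rewrite ?inl_eq ?inr_eq => /eqP e1 /eqP e2 /eqP e3 /eqP e4 P0;
  [subst j2 i3 j4 i4|subst i2 j3 i4 j4];
  move: us (lt0r_neq0 P0); rewrite !inE !inl_eq !inr_eq /= !mulf_eq0 !negb_or
    !andbT -!andbA => Hu; case/andP: Hu => n1 n2 /and4P[z1 z2 z3 z4].
- have e := K _ _ _ _ n1 n2 P0.
  (* [P0] gives nonzero entries of [A] only on the R-to-S steps; the equality [e] carries this over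
     to the S-to-R steps and so excludes infinite labels. *)
  have : A i1 j1 * A i2 j3 != 0 by rewrite e mulf_neq0.
  by rewrite mulf_eq0 negb_or e eqxx z2 z4 => /andP[-> ->].
- have e : A i3 j1 * A i1 j2 = A i1 j1 * A i3 j2.
    by apply: K => //; [rewrite eq_sym|apply: (gt0_eq _ _ P0); ring].
  have : A i3 j1 * A i1 j2 != 0 by rewrite e mulf_neq0.
  by rewrite mulf_eq0 negb_or [A i1 j2 * _]mulrC e eqxx z1 z3 => /andP[-> ->].
Qed.

Lemma six_cond_six_cycles : six_cond (-1) ->
  forall w, size w = 6%N -> e_cycle A B w -> s_cycle A B w.
Proof.
move=> K; case=> [|s1 [|s2 [|s3 [|s4 [|s5 [|s6 [|]]]]]]] // _ ew.
have := e_cycle_prod _ ew.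
case/andP: ew => ic _; rewrite /s_cycle ic /=.
case/and3P: (ic) => cw us _; rewrite s_walk6 //.
case/and3P: cw => _ _ /and5P[c1 c2 c3 c4 /and3P[c5 c6 _]].
rewrite !big_cons big_nil -signr_odd expr1 mulr1 !mulrA.
move: us c1 c2 c3 c4 c5 c6.
case: s1 s2 s3 s4 s5 s6 {ic} => [[[i1 j1] k1] d1] [[[i2 j2] k2] d2]
  [[[i3 j3] k3] d3] [[[i4 j4] k4] d4] [[[i5 j5] k5] d5] [[[i6 j6] k6] d6].
rewrite /entry /tgt /src /=.
have uniq3 (T : eqType) (x y z : T) : x != y -> x != z -> y != z ->
    uniq [:: x; y; z].
  by move=> a b c; rewrite /= !inE negb_or a b c.
case: d1; case: d2 => //; case: d3 => //; case: d4 => //; case: d5 => //;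
  case: d6 => //= us;
  rewrite ?inl_eq ?inr_eq => /eqP e1 /eqP e2 /eqP e3 /eqP e4 /eqP e5 /eqP e6 P0;
  [subst j2 i3 j4 i5 j6 i6|subst i2 j3 i4 j5 i6 j6];
  move: us (lt0r_neq0 P0); rewrite !inE !inl_eq !inr_eq /= !mulf_eq0 !negb_or
    !andbT oppr_eq0 oner_eq0 -!andbA /= => Hu;
  case/and5P: Hu => n1 n2 n3 n4 /andP[n5 n6] /and5P[z1 z2 z3 z4 /andP[z5 z6]].
- have e : A i1 j1 * A i2 j3 * A i4 j5 = -1 * (A i2 j1 * A i4 j3 * A i1 j5).
    by apply: K; [exact: uniq3|exact: uniq3|apply: (gt0_eq _ _ P0); ring].
  have : A i1 j1 * A i2 j3 * A i4 j5 != 0.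
    by rewrite e mulN1r oppr_eq0 !mulf_neq0.
  by rewrite !mulf_eq0 !negb_or e mulN1r normrN eqxx z2 z4 z6
    => /andP[/andP[-> ->] ->].
- have e : A i5 j1 * A i1 j2 * A i3 j4 = -1 * (A i1 j1 * A i3 j2 * A i5 j4).
    apply: K; [|exact: uniq3|apply: (gt0_eq _ _ P0); ring].
    by apply: uniq3; rewrite // eq_sym.
  have : A i5 j1 * A i1 j2 * A i3 j4 != 0.
    by rewrite e mulN1r oppr_eq0 !mulf_neq0.
  rewrite !mulf_eq0 !negb_or => /andP[/andP[-> ->] ->].
  rewrite z1 z3 z5 /= (_ : A i1 j2 * A i3 j4 * A i5 j1 =
    - (A i1 j1 * A i3 j2 * A i5 j4)) ?normrN //.
  by rewrite -mulN1r -e; ring.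
Qed.

(** * Lengths of cycles and the edges of a cycle at an R-vertex *)

Lemma consecutive_dir (s t : step I J) : tgt s == src t -> t.2 = ~~ s.2.
Proof. by case: s t => [s []] [t []]. Qed.

Lemma count_S_steps (w : seq (step I J)) : uniq (map (@src I J) w) ->
  (count snd w <= #|I|)%N.
Proof.
move=> us; rewrite -size_filter -(size_map (fun s => s.1.1.1)).
have u : uniq [seq s.1.1.1 | s <- filter snd w].
  rewrite -(map_inj_uniq (f := @inl I J)); last by move=> x y [].
  rewrite -map_comp; have -> :
      [seq (inl \o (fun s : step I J => s.1.1.1)) s | s <- filter snd w] =
      map (@src I J) (filter snd w).
    by apply/eq_in_map => s; rewrite mem_filter /src => /andP[-> _].
  exact: subseq_uniq (map_subseq _ (filter_subseq _ _)) us.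
by rewrite -(card_uniqP u) max_card.
Qed.

(** Alternating directions exclude odd lengths, length 2 would need parallel edges, and length at
    least 8 would need four S-vertices. *)
Lemma is_cycle_size w : (#|I| <= 3)%N -> is_cycle A B w ->
  size w = 4%N \/ size w = 6%N.
Proof.
move=> I3 /and3P[/and3P[w0 al cy] us ue].
have alt := consecutive_dir.
case: w w0 al cy us ue => [|s1 [|s2 [|s3 [|s4 [|s5 [|s6 [|s7 [|s8 w]]]]]]]] // _.
- by move=> _ /andP[/alt]; case: s1.2.
- move=> /and3P[a1 a2 _] /and3P[h1 h2 _] _ /andP[+ _].
  rewrite inE => /negP[]; apply/eqP; apply: is_edge_inj.
  + by case/andP: a1.
  + by case/andP: a2.
  case: s1 s2 h1 h2 {a1 a2} => [[[i1 j1] k1] d1] [[[i2 j2] k2] d2].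
  by case: d1; case: d2; rewrite //= /tgt /src /= ?inl_eq ?inr_eq
    => /eqP-> /eqP->.
- by move=> _ /and4P[/alt e1 /alt e2 /alt]; rewrite e2 e1; case: s1.2.
- by left.
- move=> _ /and5P[/alt e1 /alt e2 /alt e3 /alt e4 /andP[/alt]].
  by rewrite e4 e3 e2 e1; case: s1.2.
- by right.
- move=> _ /and5P[/alt e1 /alt e2 /alt e3 /alt e4 /and4P[/alt e5 /alt e6 /alt]].
  by rewrite e6 e5 e4 e3 e2 e1; case: s1.2.
move=> _ /and5P[/alt e1 /alt e2 /alt e3 /alt e4 /and4P[/alt e5 /alt e6 /alt e7 _]].
move=> us _; have := leq_trans (count_S_steps _ us) I3.
by rewrite /= e7 e6 e5 e4 e3 e2 e1; case: s1.2.
Qed.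

(** The other edge at the R-vertex belongs to the next or the previous step, depending on the
    direction of [e]. Its S-endpoint differs because endpoints determine an edge and no edge
    repeats. *)
Lemma cycle_other_edge w e : is_cycle A B w -> e \in map fst w ->
  exists2 f, f \in map fst w & [/\ f.1.2 = e.1.2, f.1.1 != e.1.1,
    is_edge A B e & is_edge A B f].
Proof.
case/and3P=> /and3P[_ al cy] us ue /mapP[s sw ->].
have ed t : t \in w -> is_edge A B t.1 by move/(allP al)/andP=> [].
have fin (t : step I J) : t \in w -> t.2 != s.2 -> t.1.1.2 = s.1.1.2 ->
    exists2 f, f \in map fst w & [/\ f.1.2 = s.1.1.2, f.1.1 != s.1.1.1,
    is_edge A B s.1 & is_edge A B f].
  move=> tw td ej; exists t.1; first exact: map_f.
  split; rewrite ?ed //; apply: contra td => /eqP ei; apply/eqP.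
  have e1 : t.1 = s.1.
    apply: is_edge_inj; rewrite ?ed //.
    by move: ei ej; case: (t.1.1) (s.1.1) => [? ?] [? ?] /= -> ->.
  have /eqP : index t w == index s w.
    rewrite -(nth_uniq s.1 _ _ ue) ?size_map ?index_mem //.
    by rewrite !(nth_map s) ?index_mem // !nth_index // e1.
  by move/(congr1 (nth s w)); rewrite !nth_index // => ->.
case ds: (s.2).
- have h := next_cycle cy sw; apply: (fin (next w s)); rewrite ?mem_next //.
  + by rewrite (consecutive_dir _ _ h); case: s.2.
  + have dh := consecutive_dir _ _ h.
    by move: h; rewrite /tgt /src dh ds /= inr_eq => /eqP->.
- have h := prev_cycle cy sw; apply: (fin (prev w s)); rewrite ?mem_prev //.
  + by rewrite (consecutive_dir _ _ h); case: (prev w s).2.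
  + have dh := consecutive_dir _ _ h.
    move: dh h; rewrite /tgt /src ds; case: (prev w s).2 => //= _.
    by rewrite inr_eq => /eqP->.
Qed.

(* The edges of a component come in pairs, one pair for each R-vertex. *)
Lemma even_component_length w1 w2 v :
  (forall j i1 i2 i3, (A i1 j != 0) || (B j i1 != 0) ->
     (A i2 j != 0) || (B j i2 != 0) -> (A i3 j != 0) || (B j i3 != 0) ->
     ~~ uniq [:: i1; i2; i3]) ->
  is_cycle A B w1 -> is_cycle A B w2 -> ~~ odd (component_length w1 w2 v).
Proof.
move=> deg2 c1 c2; rewrite /component_length; set F := [set e | _].
have adj e : is_edge A B e -> (A e.1.1 e.1.2 != 0) || (B e.1.2 e.1.1 != 0).
  case: e => [[i j] k] /=; rewrite both_same_signE.
  by case: k => [[]|] /andP[-> _]; rewrite ?orbT.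
rewrite -sum1_card (partition_big (fun e : edge I J => e.1.2) predT) //=.
apply: (big_ind (fun n => ~~ odd n)) => // [x y hx hy|j _].
  by rewrite oddD (negbTE hx) (negbTE hy).
rewrite sum1_card.
case: (pickP [pred e | (e \in F) && (e.1.2 == j)]) => [e|]; last first.
  by move=> h; rewrite eq_card0.
case/andP=> eF /eqP ej.
have [] : common_edge w1 w2 e /\ connect (inter_adj w1 w2) v (inl e.1.1).
  by move: eF; rewrite inE => /andP.
case/andP=> e1 e2 ce.
have [f f1 [fj fi ee ef]] := cycle_other_edge _ _ c1 e1.
(* Degree at most two: [f] is the only other edge at [j], so both cycles must use it. *)
have third g : is_edge A B g -> g.1.2 = j -> g.1.1 != e.1.1 -> g = f.
  move=> eg gj gi; apply: is_edge_inj => //.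
  have := deg2 j e.1.1 f.1.1 g.1.1.
  rewrite -{1 2}ej adj // -{1 2}ej -{1 2}fj adj // -{1 2}gj adj //.
  move=> /(_ isT isT isT); rewrite /= !inE !negb_or andbT.
  rewrite eq_sym fi eq_sym gi /= negbK => /eqP h.
  by move: h gj fj; rewrite ej; case: (g.1) (f.1) => ? ? [? ?] /= -> -> ->.
have [g g2 [gj gi _ eg]] := cycle_other_edge _ _ c2 e2.
have gf := third g eg (etrans gj ej) gi; subst g.
have cf : common_edge w1 w2 f by rewrite /common_edge f1.
have fF : f \in F.
  rewrite inE cf /=; apply: connect_trans ce _.
  apply: (@connect_trans _ _ (inr j)); apply: connect1; apply/existsP.
  - by exists e; rewrite /common_edge e1 e2 ej !eqxx.
  - by exists f; rewrite cf fj ej !eqxx orbT.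
rewrite (eq_card (B := mem [set e; f])); last first.
  move=> g; rewrite !inE; apply/andP/orP => [[gF /eqP gj']|].
    have [] : common_edge w1 w2 g /\ connect (inter_adj w1 w2) v (inl g.1.1).
      by move: gF; rewrite ?inE => /andP.
    case/andP=> g1 _ _.
    have [_ _ [_ _ ig _]] := cycle_other_edge _ _ c1 g1.
    have [gie|gne] := eqVneq g.1.1 e.1.1.
      left; apply/eqP; apply: is_edge_inj => //.
      by move: gie gj'; rewrite -ej; case: (g.1) (e.1) => ? ? [? ?] /= -> ->.
    by right; rewrite (third g).
  by case=> /eqP->; split; rewrite ?eF ?fF ?fj ?ej //; move: eF fF; rewrite !inE.
rewrite cards2; case: eqVneq => // ef'.
by move: fi; rewrite -ef' eqxx.
Qed.

End SignedGraph.

(** * Signs of products of corresponding minors *)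

Section MinorProducts.

Variables (R : realType) (I J : finType) (A : I -> J -> R) (B : J -> I -> R).
Hypothesis AB : sign_compatible R I J A B.
Hypothesis K4 : four_cond R I J A B.
Hypothesis K6 : six_cond R I J A B 1.

(** If only [j1] and [j2] coincide, [A i2 j1 * B j1 i2] is an edge walked back and forth; cancelling
    this nonnegative factor leaves a positive 4-cycle for [K4]. If all three coincide, both sides
    are the same monomial. *)
Lemma six_cond_repeated i1 i2 i3 j1 j2 j3 : uniq [:: i1; i2; i3] ->
  0 < B j1 i1 * A i2 j1 * B j2 i2 * A i3 j2 * B j3 i3 * A i1 j3 ->
  A i1 j1 * A i2 j2 * A i3 j3 = A i2 j1 * A i3 j2 * A i1 j3.
Proof.
have H a b c j k : uniq [:: a; b; c] -> j != k ->
    0 < B j a * A b j * B j b * A c j * B k c * A a k ->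
    A a j * A b j * A c k = A b j * A c j * A a k.
  rewrite /= !inE negb_or !andbT => /andP[/andP[_ ac] _] jk P0.
  suff e : A a j * A c k = A c j * A a k.
    by transitivity (A b j * (A a j * A c k)); [|rewrite e]; ring.
  apply: K4 => //.
  rewrite -(pmulr_rgt0 (x := A b j * B j b)).
    by apply: (gt0_eq _ _ _ P0); ring.
  rewrite lt_def sign_compatible_mul_ge0 // andbT.
  apply/negP => /eqP z.
  suff : B j a * A b j * B j b * A c j * B k c * A a k = 0.
    by move=> e; rewrite e ltxx in P0.
  rewrite (_ : _ * _ = (A b j * B j b) * (B j a * A c j * B k c * A a k));
    [by rewrite z mul0r|ring].
move=> u P0.
(* The other coincidences reduce to [j1 = j2] by rotating the walk. *)
have u' : uniq [:: i2; i3; i1] by rewrite -(rot_uniq 1) in u.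
have u'' : uniq [:: i3; i1; i2] by rewrite -(rot_uniq 1) in u'.
have [e12|n12] := eqVneq j1 j2; have [e13|n13] := eqVneq j1 j3.
- by rewrite -e12 -e13; ring.
- by rewrite -e12; apply: H => //; rewrite -e12 in P0.
- rewrite -e13; have := H i3 i1 i2 j1 j2 u'' n12.
  rewrite -e13 in P0 => h; have := h _.
  rewrite (_ : A i1 j1 * A i2 j2 * A i3 j1 = A i3 j1 * A i1 j1 * A i2 j2);
    last by ring.
  by move=> ->; [ring|apply: (gt0_eq _ _ _ P0); ring].
have [e23|n23] := eqVneq j2 j3.
- rewrite -e23 in P0 *; have h := H i2 i3 i1 j2 j1 u'; rewrite eq_sym in h.
  move: (h n12).
  rewrite (_ : A i1 j1 * A i2 j2 * A i3 j2 = A i2 j2 * A i3 j2 * A i1 j1);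
    last by ring.
  by move=> ->; [ring|apply: (gt0_eq _ _ _ P0); ring].
have := K6 i1 i2 i3 j1 j2 j3 u; rewrite !mul1r; apply => //.
by rewrite /= !inE negb_or n12 n13 n23.
Qed.

(** In the expanded product the diagonal terms are nonnegative by sign compatibility. The two mixed
    monomials carry a minus sign; if one of them is positive, [K4] makes the minor of [A] vanish. *)
Lemma minor2_mul_ge0 i i' j j' : i != i' ->
  0 <= (A i j * A i' j' - A i' j * A i j') *
       (B j i * B j' i' - B j i' * B j' i).
Proof.
move=> ni; have [->|nj] := eqVneq j j'.
  by rewrite [A i j' * _]mulrC subrr mul0r.
have [h|h1] := ltP 0 (B j i * A i' j * B j' i' * A i j').
  by rewrite (K4 _ _ _ _ ni nj h) subrr mul0r.
have [h|h2] := ltP 0 (B j i' * A i j * B j' i * A i' j').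
  by rewrite eq_sym in ni; rewrite (K4 _ _ _ _ ni nj h) subrr mul0r.
have h3 := mulr_ge0 (sign_compatible_mul_ge0 _ _ _ _ _ AB i j)
  (sign_compatible_mul_ge0 _ _ _ _ _ AB i' j').
have h4 := mulr_ge0 (sign_compatible_mul_ge0 _ _ _ _ _ AB i j')
  (sign_compatible_mul_ge0 _ _ _ _ _ AB i' j).
lra.
Qed.

(* This is the 3 x 3 minor of the lifted matrices on three columns with distinct
   second indices. *)
Lemma cyclic_minor3_mul_ge0 i1 i2 i3 j1 j2 j3 : uniq [:: i1; i2; i3] ->
  0 <= (A i1 j1 * A i2 j2 * A i3 j3 - A i2 j1 * A i3 j2 * A i1 j3) *
       (B j1 i1 * B j2 i2 * B j3 i3 - B j1 i2 * B j2 i3 * B j3 i1).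
Proof.
move=> u.
have u' : uniq [:: i2; i1; i3].
  by move: u; rewrite /= !inE !negb_or eq_sym => /andP[/andP[-> ->] /andP[->]].
have [h|h1] := ltP 0 (B j1 i1 * A i2 j1 * B j2 i2 * A i3 j2 * B j3 i3 * A i1 j3).
  by rewrite (six_cond_repeated _ _ _ _ _ _ u h) subrr mul0r.
(* The second mixed monomial belongs to the first walk traversed backwards. *)
have [h|h2] := ltP 0 (B j1 i2 * A i1 j1 * B j3 i1 * A i3 j3 * B j2 i3 * A i2 j2).
  have e := six_cond_repeated _ _ _ _ _ _ u' h.
  rewrite (_ : _ - _ = 0) ?mul0r //.
  rewrite (_ : A i2 j1 * _ * _ = A i2 j1 * A i1 j3 * A i3 j2); last by ring.
  by rewrite e; ring.
pose p i j := sign_compatible_mul_ge0 _ _ _ _ _ AB i j.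
have h3 := mulr_ge0 (mulr_ge0 (p i1 j1) (p i2 j2)) (p i3 j3).
have h4 := mulr_ge0 (mulr_ge0 (p i2 j1) (p i3 j2)) (p i1 j3).
lra.
Qed.

End MinorProducts.

(** * The Cauchy-Binet formula, summed over functions *)

Section CauchyBinet.

Variables (R : comNzRingType) (n : nat) (K : finType).
Variables (U : 'I_n -> K -> R) (V : K -> 'I_n -> R).

Lemma det_sum_mul : \det (\matrix_(i, j) \sum_k U i k * V k j) =
  \sum_(f : {ffun 'I_n -> K})
    (\prod_i U i (f i)) * \det (\matrix_(i, j) V (f i) j).
Proof.
rewrite /determinant.
under eq_bigr => s _.
  under [X in _ * X]eq_bigr => i _ do rewrite mxE.
  rewrite bigA_distr_bigA big_distrr /=; over.
rewrite exchange_big /=; apply: eq_bigr => f _.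
rewrite big_distrr /=; apply: eq_bigr => s _.
rewrite big_split /= mulrCA; congr (_ * (_ * _)).
by apply: eq_bigr => i _; rewrite mxE.
Qed.

(** Noninjective [f] contribute zero and each subset is counted [n!] times, so this is the usual
    formula without choosing an order on [K]. *)
Lemma cauchy_binet_fact : n`!%:R * \det (\matrix_(i, j) \sum_k U i k * V k j) =
  \sum_(f : {ffun 'I_n -> K})
    \det (\matrix_(i, j) U i (f j)) * \det (\matrix_(i, j) V (f i) j).
Proof.
rewrite -(card_Sn n) -sum1_card natr_sum mulr_suml.
under [RHS]eq_bigr => f _ do rewrite {1}/determinant mulr_suml.
rewrite exchange_big /=; apply: eq_big => [s|s _]; first by rewrite inE.
rewrite mul1r det_sum_mul.
(* Precomposing [f] with [s] permutes the rows of the minor of [V]; the resulting sign is that of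
   [s] in the expansion of the minor of [U]. *)
rewrite (reindex (fun f : {ffun 'I_n -> K} => [ffun i => f (s i)])) /=; last first.
  exists (fun f : {ffun 'I_n -> K} => [ffun i => f ((s^-1)%g i)]) => f _;
    by apply/ffunP => i; rewrite !ffunE ?permK ?permKV.
apply: eq_bigr => f _.
have -> : \matrix_(i, j) V ([ffun i0 => f (s i0)] i) j =
    row_perm s (\matrix_(i, j) V (f i) j).
  by apply/matrixP => i j; rewrite !mxE ffunE.
rewrite row_permE det_mulmx det_perm mulrA [_ * (-1) ^+ s]mulrC.
by congr (_ * _ * _); apply: eq_bigr => i _; rewrite !mxE ffunE.
Qed.

End CauchyBinet.

(** * Three-element index sets and small determinants *)

Definition o0 : 'I_3 := ord0.
Definition o1 : 'I_3 := @Ordinal 3 1 isT.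
Definition o2 : 'I_3 := @Ordinal 3 2 isT.

Lemma ord3_ind (P : 'I_3 -> Prop) : P o0 -> P o1 -> P o2 -> forall i, P i.
Proof.
move=> h0 h1 h2 [[|[|[|i]]] hi] //.
- by have -> : Ordinal hi = o0 by apply: val_inj.
- by have -> : Ordinal hi = o1 by apply: val_inj.
- by have -> : Ordinal hi = o2 by apply: val_inj.
Qed.

Definition p01 : pairs 3 := exist _ (o0, o1) isT.
Definition p02 : pairs 3 := exist _ (o0, o2) isT.
Definition p12 : pairs 3 := exist _ (o1, o2) isT.

Lemma pairs3_ind (P : pairs 3 -> Prop) :
  P p01 -> P p02 -> P p12 -> forall p, P p.
Proof.
move=> h01 h02 h12 [[i j] ij].
elim/ord3_ind: i ij; elim/ord3_ind: j => // ij.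
- by have -> : exist _ (o0, o1) ij = p01 by apply: val_inj.
- by have -> : exist _ (o0, o2) ij = p02 by apply: val_inj.
- by have -> : exist _ (o1, o2) ij = p12 by apply: val_inj.
Qed.

(** This is the lexicographic order, not the labelling by omitted index: [o0] goes to the pair
    omitting [o2]. *)
Definition pair_of_ord (i : 'I_3) : pairs 3 :=
  match val i with 0%N => p01 | 1%N => p02 | _ => p12 end.

Definition ord_of_pair (p : pairs 3) : 'I_3 :=
  if p == p01 then o0 else if p == p02 then o1 else o2.

Lemma ord_of_pairK : cancel ord_of_pair pair_of_ord.
Proof. by elim/pairs3_ind. Qed.

Lemma pair_of_ordK : cancel pair_of_ord ord_of_pair.
Proof. by elim/ord3_ind. Qed.

Lemma card_pairs3 : (#|{: pairs 3}| <= 3)%N.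
Proof. by rewrite -[leqRHS](card_ord 3) (leq_card _ (can_inj ord_of_pairK)). Qed.

Lemma det_mx22 (R : comNzRingType) (M : 'M[R]_2) :
  \det M = M ord0 ord0 * M ord_max ord_max - M ord0 ord_max * M ord_max ord0.
Proof.
rewrite (expand_det_row M ord0) !big_ord_recl big_ord0 /cofactor !det_mx11 !mxE /=.
rewrite (_ : lift ord0 ord0 = ord_max); last exact: val_inj.
rewrite (_ : lift ord_max ord0 = ord0); last exact: val_inj.
ring.
Qed.

Lemma sum_ord3 (V : nmodType) (F : 'I_3 -> V) :
  \sum_i F i = F o0 + F o1 + F o2.
Proof.
rewrite !big_ord_recl big_ord0 addr0 addrA; congr (_ + F _ + F _);
  exact: val_inj.
Qed.

Lemma mxtrace3 (R : comNzRingType) (M : 'M[R]_3) :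
  \tr M = M o0 o0 + M o1 o1 + M o2 o2.
Proof. exact: sum_ord3. Qed.

Lemma det_mx33 (R : comNzRingType) (M : 'M[R]_3) : \det M =
  M o0 o0 * (M o1 o1 * M o2 o2 - M o1 o2 * M o2 o1)
  - M o0 o1 * (M o1 o0 * M o2 o2 - M o1 o2 * M o2 o0)
  + M o0 o2 * (M o1 o0 * M o2 o1 - M o1 o1 * M o2 o0).
Proof.
rewrite (expand_det_row M o0) sum_ord3 /cofactor !det_mx22 !mxE /=.
have e1 : lift o0 (ord0 : 'I_2) = o1 by exact: val_inj.
have e2 : lift o0 (ord_max : 'I_2) = o2 by exact: val_inj.
have e3 : lift o1 (ord0 : 'I_2) = o0 by exact: val_inj.
have e4 : lift o1 (ord_max : 'I_2) = o2 by exact: val_inj.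
have e5 : lift o2 (ord0 : 'I_2) = o0 by exact: val_inj.
have e6 : lift o2 (ord_max : 'I_2) = o1 by exact: val_inj.
by rewrite e1 e2 e3 e4 e5 e6; ring.
Qed.

(** * The lifted matrices for three S-vertices *)

Section Lift.

Variables (R : realType) (m : nat) (A : 'M[R]_(3, m)) (B : 'M[R]_(m, 3)).

Lemma LAE (k : 'I_m) :
  (LA A p01 (k, o0) = A o1 k) * (LA A p01 (k, o1) = - A o0 k) *
  (LA A p01 (k, o2) = 0) * (LA A p02 (k, o0) = A o2 k) *
  (LA A p02 (k, o1) = 0) * (LA A p02 (k, o2) = - A o0 k) *
  (LA A p12 (k, o0) = 0) * (LA A p12 (k, o1) = A o2 k) *
  (LA A p12 (k, o2) = - A o1 k).
Proof. by []. Qed.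

Lemma LBE (k : 'I_m) :
  (LB B (k, o0) p01 = B k o1) * (LB B (k, o1) p01 = - B k o0) *
  (LB B (k, o2) p01 = 0) * (LB B (k, o0) p02 = B k o2) *
  (LB B (k, o1) p02 = 0) * (LB B (k, o2) p02 = - B k o0) *
  (LB B (k, o0) p12 = 0) * (LB B (k, o1) p12 = B k o2) *
  (LB B (k, o2) p12 = - B k o1).
Proof. by []. Qed.

Let A' := fun i j => A i j.
Let B' := fun i j => B i j.

Hypothesis AB : sign_compatible _ _ _ A' B'.

Lemma lift_sign_compatible : sign_compatible _ _ _ (LA A) (LB B).
Proof.
move=> p [k l]; elim/pairs3_ind: p; elim/ord3_ind: l; rewrite !LAE !LBE ?eqxx //;
  rewrite ?oppr_eq0 ?sgrN => a b; rewrite (AB _ _ a b) //.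
Qed.

Lemma lift_degree (j : 'I_m * 'I_3) (p1 p2 p3 : pairs 3) :
  (LA A p1 j != 0) || (LB B j p1 != 0) ->
  (LA A p2 j != 0) || (LB B j p2 != 0) ->
  (LA A p3 j != 0) || (LB B j p3 != 0) -> ~~ uniq [:: p1; p2; p3].
Proof.
case: j => k l; elim/ord3_ind: l; elim/pairs3_ind: p1; elim/pairs3_ind: p2;
  elim/pairs3_ind: p3 => //; rewrite !LAE !LBE ?eqxx //.
Qed.

Hypothesis K4 : four_cond _ _ _ A' B'.

(** Two distinct pairs share one index, which forces [l = l']. The signs of the lift enter the
    monomial twice and cancel, leaving a 4-cycle on the two unshared indices. *)
Lemma lift_four_cond : four_cond _ _ _ (LA A) (LB B).
Proof.
(* The separate equation for [x] lets [ring] absorb the signs of the lift. *)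
have H i i' k k' x : i != i' -> k != k' -> 0 < x ->
    x = B k i * A i' k * B k' i' * A i k' -> A i k * A i' k' = A i' k * A i k'.
  by move=> ? ? ? e; apply: K4; rewrite // -e.
move=> p p' [k l] [k' l'] + + P0.
elim/pairs3_ind: p P0; elim/pairs3_ind: p' => //; elim/ord3_ind: l;
  elim/ord3_ind: l'; rewrite !LAE !LBE ?(mulr0, mul0r) ?ltxx // => P0 _;
  rewrite xpair_eqE eqxx andbT => nk.
all: by first [
    have e := H o1 o2 k k' _ isT nk P0 ltac:(ring); lra
  | have e := H o2 o1 k k' _ isT nk P0 ltac:(ring); lra
  | have e := H o0 o1 k k' _ isT nk P0 ltac:(ring); lra
  | have e := H o1 o0 k k' _ isT nk P0 ltac:(ring); lra
  | have e := H o0 o2 k k' _ isT nk P0 ltac:(ring); lra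
  | have e := H o2 o0 k k' _ isT nk P0 ltac:(ring); lra].
Qed.

Hypothesis K6 : six_cond _ _ _ A' B' 1.

(** Read through omitted indices, the lifted walk runs backwards, hence the order [k1 k3 k2], and
    the signs of the lift multiply to [-1]. The three [l] differ, so some [k] may coincide;
    [six_cond_repeated] covers this. *)
Lemma lift_six_cond : six_cond _ _ _ (LA A) (LB B) (-1).
Proof.
have H i1 i2 i3 k1 k2 k3 x : uniq [:: i1; i2; i3] -> 0 < x ->
    x = B k1 i1 * A i2 k1 * B k2 i2 * A i3 k2 * B k3 i3 * A i1 k3 ->
    A i1 k1 * A i2 k2 * A i3 k3 = A i2 k1 * A i3 k2 * A i1 k3.
  by move=> u P0 e; apply: (six_cond_repeated _ _ _ _ _ AB K4 K6); rewrite // -e.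
move=> p1 p2 p3 [k1 l1] [k2 l2] [k3 l3] + _.
elim/pairs3_ind: p1; elim/pairs3_ind: p2 => //; elim/pairs3_ind: p3 => // _;
elim/ord3_ind: l1; rewrite !LAE !LBE ?(mulr0, mul0r) ?ltxx //; elim/ord3_ind: l2;
rewrite !LAE !LBE ?(mulr0, mul0r) ?ltxx //;
  elim/ord3_ind: l3; rewrite !LAE !LBE ?(mulr0, mul0r) ?ltxx // => P0.
all: by first [
    have e := H o0 o1 o2 k1 k3 k2 _ isT P0 ltac:(ring); lra
  | have e := H o0 o2 o1 k1 k3 k2 _ isT P0 ltac:(ring); lra
  | have e := H o1 o0 o2 k1 k3 k2 _ isT P0 ltac:(ring); lra
  | have e := H o1 o2 o0 k1 k3 k2 _ isT P0 ltac:(ring); lra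
  | have e := H o2 o0 o1 k1 k3 k2 _ isT P0 ltac:(ring); lra
  | have e := H o2 o1 o0 k1 k3 k2 _ isT P0 ltac:(ring); lra].
Qed.

Lemma lift_odd_star : odd_star (LA A) (LB B).
Proof.
have cAB := lift_sign_compatible; split=> [w ew|w1 w2 /andP[c1 _] /andP[c2 _]].
  have [ic _] := andP ew.
  have [s4|s6] := is_cycle_size _ _ _ _ _ cAB _ card_pairs3 ic.
    exact: (four_cond_four_cycles _ _ _ _ _ cAB lift_four_cond).
  exact: (six_cond_six_cycles _ _ _ _ _ cAB lift_six_cond).
case=> _ [v cv] /(_ v cv); apply/negP.
exact: (even_component_length _ _ _ _ _ cAB w1 w2 v lift_degree).
Qed.

(** [LB] sends e_i /\ e_j to B e_j tensor e_i minus B e_i tensor e_j, and [LA] sends e_k tensor e_l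
    to e_l /\ A e_k; their composite is the compound. *)
Lemma compound2_entry_sum (p q : pairs 3) :
  compound2_entry (A *m B) p q = \sum_kl LA A p kl * LB B kl q.
Proof.
rewrite -(pair_bigA _ (fun k l => LA A p (k, l) * LB B (k, l) q)) /=.
rewrite /compound2_entry /= !mxE !mulr_sumr -sumrB -big_split -sumrB /=.
apply: eq_bigr => k _; rewrite sum_ord3.
by elim/pairs3_ind: p; elim/pairs3_ind: q; rewrite !LAE !LBE /=
  -?[o0 == o1]/false -?[o1 == o0]/false -?[o0 == o2]/false -?[o2 == o0]/false
  -?[o1 == o2]/false -?[o2 == o1]/false ?eqxx /=; ring.
Qed.

Lemma lift_minor2_mul_ge0 p q j j' : p != q ->
  0 <= (LA A p j * LA A q j' - LA A p j' * LA A q j) *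
       (LB B j p * LB B j' q - LB B j q * LB B j' p).
Proof.
move=> npq; apply: (ge0_eq _ _ _ (minor2_mul_ge0 _ _ _ _ _ lift_sign_compatible
  lift_four_cond _ _ j j' npq)); ring.
Qed.

(** The second components of the [f j] decide: all equal gives a zero row, all distinct leaves only
    the two cyclic monomials, and exactly two equal makes the determinant split. *)
Lemma lift_det_mul_ge0 (f : 'I_3 -> 'I_m * 'I_3) :
  0 <= \det (\matrix_(i, j) LA A (pair_of_ord i) (f j)) *
       \det (\matrix_(i, j) LB B (f i) (pair_of_ord j)).
Proof.
have p1 i k := sign_compatible_mul_ge0 _ _ _ _ _ AB i k.
have p2 i i' k k' := minor2_mul_ge0 _ _ _ _ _ AB K4 i i' k k'.
have p3 := cyclic_minor3_mul_ge0 _ _ _ _ _ AB K4 K6.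
rewrite {}/A' {}/B' in p1 p2 p3.
rewrite !det_mx33 !mxE.
rewrite -[pair_of_ord o0]/p01 -[pair_of_ord o1]/p02 -[pair_of_ord o2]/p12.
case: (f o0) (f o1) (f o2) => [k1 l1] [k2 l2] [k3 l3].
elim/ord3_ind: l1; elim/ord3_ind: l2; elim/ord3_ind: l3; rewrite !LAE !LBE.
(* The two columns sharing their second index contribute a 2 x 2 minor of A,
   the remaining column a single entry. *)
all: let close h := solve [apply: (ge0_eq _ _ _ h); ring] in
  let cyclic a b c := close (p3 o1 o2 o0 a b c isT) in
  let split_off a b c := first
    [ close (mulr_ge0 (p1 o0 a) (p2 o0 o1 b c isT))
    | close (mulr_ge0 (p1 o1 a) (p2 o0 o1 b c isT))
    | close (mulr_ge0 (p1 o0 a) (p2 o0 o2 b c isT))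
    | close (mulr_ge0 (p1 o2 a) (p2 o0 o2 b c isT))
    | close (mulr_ge0 (p1 o1 a) (p2 o1 o2 b c isT))
    | close (mulr_ge0 (p1 o2 a) (p2 o1 o2 b c isT))] in
  first [close (lexx (0 : R)) | cyclic k1 k2 k3 | cyclic k2 k3 k1
  | cyclic k3 k1 k2 | cyclic k1 k3 k2 | cyclic k2 k1 k3 | cyclic k3 k2 k1
  | split_off k1 k2 k3 | split_off k2 k1 k3 | split_off k3 k1 k2].
Qed.

Lemma lift_minor_mul_ge0 r (g : 'I_r -> pairs 3) (f : 'I_r -> 'I_m * 'I_3) :
  injective g ->
  0 <= \det (\matrix_(i, j) LA A (g i) (f j)) *
       \det (\matrix_(i, j) LB B (f i) (g j)).
Proof.
move=> ginj.
have r3 : (r <= 3)%N.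
  by rewrite -(card_ord r) (leq_trans (leq_card _ ginj)) ?card_pairs3.
case: r g f ginj r3 => [|[|[|[|//]]]] g f ginj _.
- by rewrite !det_mx00 mulr1.
- by rewrite !det_mx11 !mxE sign_compatible_mul_ge0 //; exact: lift_sign_compatible.
- rewrite !det_mx22 !mxE; apply: lift_minor2_mul_ge0.
  by rewrite (inj_eq ginj).
(* For [r = 3], [g] lists all pairs in some order; the sign of that order occurs in both
   determinants and cancels. *)
have hinj : injective (ord_of_pair \o g).
  exact: inj_comp (can_inj ord_of_pairK) ginj.
pose s := perm hinj.
have gE i : g i = pair_of_ord (s i) by rewrite permE /= ord_of_pairK.
have -> : \matrix_(i, j) LA A (g i) (f j) =
    row_perm s (\matrix_(i, j) LA A (pair_of_ord i) (f j)).
  by apply/matrixP => i j; rewrite !mxE gE.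
have -> : \matrix_(i, j) LB B (f i) (g j) =
    col_perm s (\matrix_(i, j) LB B (f i) (pair_of_ord j)).
  by apply/matrixP => i j; rewrite !mxE gE.
rewrite row_permE col_permE !det_mulmx !det_perm odd_permV.
rewrite [X in _ * X]mulrC mulrACA -signr_addb addbb expr0 mul1r.
exact: lift_det_mul_ge0.
Qed.

(** Allowing any injective [g] covers all principal minors as well as the full determinant in the
    order of [pair_of_ord]. *)
Lemma det_compound2_ge0 r (g : 'I_r -> pairs 3) : injective g ->
  0 <= \det (\matrix_(i, j) compound2_entry (A *m B) (g i) (g j)).
Proof.
move=> ginj.
have -> : \matrix_(i, j) compound2_entry (A *m B) (g i) (g j) =
    \matrix_(i, j) \sum_kl LA A (g i) kl * LB B kl (g j).
  by apply/matrixP => i j; rewrite !mxE compound2_entry_sum.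
rewrite -(pmulr_rge0 (x := r`!%:R)) ?ltr0n ?fact_gt0 //.
rewrite (cauchy_binet_fact _ _ _ (fun i => LA A (g i)) (fun k j => LB B k (g j))).
by apply: sumr_ge0 => f _; apply: lift_minor_mul_ge0.
Qed.

Lemma compound2_P0 : P0_matrix (compound2 (A *m B)).
Proof.
move=> S; have -> : principal_submx (compound2 (A *m B)) S =
    \matrix_(i, j) compound2_entry (A *m B)
      (enum_val (enum_val i)) (enum_val (enum_val j)).
  by apply/matrixP => i j; rewrite !mxE.
apply: (det_compound2_ge0 _ (fun i : 'I_#|S| => enum_val (enum_val i))).
by move=> i j /enum_val_inj/enum_val_inj.
Qed.

End Lift.

(** * The determinant of the compound and nonreal eigenvalues *)

Lemma det_compound2_ord3 (R : realType) (M : 'M[R]_3) :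
  \det (\matrix_(i, j) compound2_entry M (pair_of_ord i) (pair_of_ord j)) =
  \tr M * (M o0 o0 * M o1 o1 - M o0 o1 * M o1 o0 +
           (M o0 o0 * M o2 o2 - M o0 o2 * M o2 o0) +
           (M o1 o1 * M o2 o2 - M o1 o2 * M o2 o1)) - \det M.
Proof.
rewrite !det_mx33 !mxE /compound2_entry /= mxtrace3.
rewrite -?[o0 == o1]/false -?[o1 == o0]/false -?[o0 == o2]/false -?[o2 == o0]/false
  -?[o1 == o2]/false -?[o2 == o1]/false ?eqxx /=; ring.
Qed.

(** [e1 * e2 - e3] is the product of the pairwise sums of the roots. With the real third root
    [c = e1 - 2 * a], these are [2 * a] and the conjugates of real part [a + c = e1 - a] and
    imaginary parts [b] and [- b]. *)
Lemma nonreal_root_cubic (R : realType) (a b e1 e2 e3 : R) (l := Complex a b) :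
  b != 0 -> 0 <= e1 * e2 - e3 ->
  l ^+ 3 - e1%:C%C * l ^+ 2 + e2%:C%C * l - e3%:C%C = 0 -> 0 <= a.
Proof.
move=> b0 h /eqP; rewrite /l !exprS expr0 eq_complex /= => /andP[/eqP re /eqP im].
(* The imaginary part of the equation, divided by [b], determines [e2]. *)
have q : e2 = 2 * e1 * a + b ^+ 2 - 3 * a ^+ 2.
  apply: (mulfI b0); apply/eqP; rewrite -subr_eq0; apply/eqP.
  rewrite -[RHS]im; ring.
rewrite leNgt; apply/negP => a0.
have e : e1 * e2 - e3 = 2 * a * ((e1 - a) ^+ 2 + b ^+ 2).
  transitivity (e1 * e2 - e3 - 0); first by rewrite subr0.
  rewrite -re q; ring.
have : 0 < (e1 - a) ^+ 2 + b ^+ 2 by rewrite ltr_wpDl ?sqr_ge0 // exprn_even_gt0.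
move: h; rewrite e; nra.
Qed.

Lemma nonreal_eigenvalue_ge0 (R : realType) (M : 'M[R]_3) (l : R[i]) :
  0 <= \det (\matrix_(i, j) compound2_entry M (pair_of_ord i) (pair_of_ord j)) ->
  eigenvalue (map_mx (fun x : R => x%:C%C) M) l -> complex.Im l != 0 ->
  0 <= complex.Re l.
Proof.
rewrite det_compound2_ord3 => h ev; case: l ev => a b ev /= b0.
apply: (nonreal_root_cubic _ _ _ _ _ _ b0 h).
set l := Complex a b in ev *.
have /eqP : \det (map_mx (fun x : R => x%:C%C) M - l%:M) = 0.
  apply/eqP; apply: contraTT ev; rewrite -unitfE -unitmxE => u.
  by rewrite /eigenvalue /eigenspace negbK kermx_eq0 row_free_unit.
rewrite det_mx33 !mxE /=.
rewrite -?[o0 == o1]/false -?[o1 == o0]/false -?[o0 == o2]/false -?[o2 == o0]/false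
  -?[o1 == o2]/false -?[o2 == o1]/false ?eqxx /= ?mulr0n ?mulr1n ?subr0 => /eqP e.
rewrite det_mx33 mxtrace3 !(rmorphD, rmorphB, rmorphM, rmorphN) /=.
(* The cubic is the determinant of [l - M], the opposite of the one in [e]. *)
by rewrite -[RHS]oppr0 -e; ring.
Qed.

Theorem theorem6p1 (R : realType) (m : nat) (C A : 'M[R]_(3, m)) (B : 'M[R]_(m, 3)) :
  (0 < m)%N ->
  Q0 C A -> Q0 C B^T ->
  (forall w : seq (step 'I_3 'I_m), size w = 4%N ->
     e_cycle (fun i j => A i j) (fun j i => B j i) w ->
     s_cycle (fun i j => A i j) (fun j i => B j i) w) ->
  (forall w : seq (step 'I_3 'I_m), size w = 6%N ->
     o_cycle (fun i j => A i j) (fun j i => B j i) w ->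
     s_cycle (fun i j => A i j) (fun j i => B j i) w) ->
  [/\ DSR2_odd_star A B,
      P0_matrix (compound2 (A *m B)) &
      forall lam : R[i],
        eigenvalue (map_mx (fun x : R => x%:C%C) (A *m B)) lam ->
        complex.Im lam != 0 -> ~ (complex.Re lam < 0)].
Proof.
move=> _ QA QB H4 H6.
(* Nonzero entries of [A] and [B^T] in the same position both have the sign of that entry of [C]. *)
have AB : sign_compatible _ _ _ (fun i j => A i j) (fun j i => B j i).
  move=> i j /= A0 B0; have [z|->] := QA i j; first by rewrite z eqxx in A0.
  have := QB i j; rewrite mxE => -[z|->//].
  by rewrite z eqxx in B0.
have K4 := four_cycles_four_cond _ _ _ _ _ AB H4.
have K6 := six_cycles_six_cond _ _ _ _ _ AB H6.
split; [exact: lift_odd_star|exact: compound2_P0|].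
move=> lam ev im0; apply/negP; rewrite -leNgt.
apply: nonreal_eigenvalue_ge0 ev im0.
apply: det_compound2_ge0 => //; exact: can_inj pair_of_ordK.
Qed.
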